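(* Let $\beta>0$ and let $G$ be a connected weakly $(n,\beta)$-graph. Then $$t'(G)>\frac{1-\beta}{2\beta}\qquad\text{and}\qquad t(G)>\frac{5(1-\beta)}{11\beta}.$$ Furthermore, for any $\varepsilon>0$, if $n$ is large enough, then $t(G)>\left(\frac12-\varepsilon\right)\frac{1-\beta}{\beta}$.
   Context: All graphs are finite, simple and nonempty. The toughness $t(G)$ of a connected graph $G$ is the minimum of $\frac{|S|}{c(G-S)}$ over all proper subsets $S\subset V(G)$ with $G-S$ disconnected, where $c(G-S)$ is the number of components of $G-S$ (it is $\infty$ for complete graphs). $t'(G)$ is the minimum of $\frac{|S|}{c(G-S)-1}$ over all proper subsets $S\subset V(G)$ with $G-S$ disconnected. A graph $G$ on $n$ vertices is a weakly $(n,\beta)$-graph if $\frac{|X||Y|}{(n-|X|)(n-|Y|)}\le\beta^2$ for every pair of disjoint proper subsets $X,Y$ of $V(G)$ with no edge between $X$ and $Y$.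
   Formalization: In the ''furthermore'' part it is assumed that β ≤ 1 or ε ≤ 1/2: for β > 1 and ε > 1/2 the claim is false, since stars K_{1,n-1} are weakly (n,β)-graphs of toughness 1/(n-1) while the bound is a positive constant. *)

(* Defs.v *)
From HB Require Import structures.
From mathcomp Require Import all_boot all_order all_algebra.
From mathcomp Require Import reals constructive_ereal.

Set Implicit Arguments.
Unset Strict Implicit.
Unset Printing Implicit Defensive.

Import Order.TTheory GRing.Theory Num.Theory.
Local Open Scope ring_scope.

(* Nonemptiness is not part of the structure, so that [del_graph G S] is
   defined for every [S]; it is assumed where it matters. *)
Record sgraph := SGraph {
  vertex :> finType;
  adj : rel vertex;
  adj_sym : symmetric adj;
  adj_irr : irreflexive adj }.

Section Graph.
Variable G : sgraph.

Definition connected_graph : bool :=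
  [forall x : G, forall y : G, connect (@adj G) x y].

Definition ncomponents : nat := n_comp (@adj G) [set: G].

Variable S : {set G}.

Definition del_adj : rel {x : G | x \notin S} :=
  fun x y => adj (val x) (val y).

Lemma del_adj_sym : symmetric del_adj.
Proof. by move=> x y; rewrite /del_adj adj_sym. Qed.

Lemma del_adj_irr : irreflexive del_adj.
Proof. by move=> x; rewrite /del_adj adj_irr. Qed.

Definition del_graph : sgraph := SGraph del_adj_sym del_adj_irr.

End Graph.

Definition disconnecting (G : sgraph) (S : {set G}) : bool :=
  (S \proper [set: G]) && ~~ connected_graph (del_graph S).

(* The minimum over the empty family, i.e. for complete graphs, is [+oo]. *)
Definition toughness (R : realType) (G : sgraph) : \bar R :=
  \big[Order.min/+oo%E]_(S : {set G} | disconnecting S)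
    (#|S|%:R / (ncomponents (del_graph S))%:R)%:E.

Definition toughness' (R : realType) (G : sgraph) : \bar R :=
  \big[Order.min/+oo%E]_(S : {set G} | disconnecting S)
    (#|S|%:R / ((ncomponents (del_graph S))%:R - 1))%:E.

Definition weakly_nbeta_graph (R : realType) (n : nat) (beta : R)
    (G : sgraph) : Prop :=
  #|G| = n /\
  forall X Y : {set G},
    X \proper [set: G] -> Y \proper [set: G] -> [disjoint X & Y] ->
    (forall x y, x \in X -> y \in Y -> ~~ adj x y) ->
    (#|X|%:R * #|Y|%:R) / ((n%:R - #|X|%:R) * (n%:R - #|Y|%:R)) <= beta ^+ 2.

(* Main.v *)
(* Write g = (1 - beta) / (2 beta), and let G - S have c components, s = |S|.
   Distributing the components into two groups X and Y of sizes c/2 rounded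
   down and up, the weak (n, beta) condition becomes
   4 g (g + 1) |X| |Y| <= s (s + |X| + |Y|).  If both |X| and |Y| are at least
   k/2, this forces s >= g k.  One can always take k = c - 1, and even k = c
   when c is even or some component is not a single vertex (put that component
   in the smaller group).  Otherwise c is odd and G - S consists of c isolated
   vertices, so that 4 |X| |Y| = c^2 - 1: this suffices for the constant 10/11,
   and it cannot happen with s < (1 - 2 eps) g c when n is large, since
   s > g (c - 1) then bounds c and n = s + c. *)
Require Import Defs.
From mathcomp Require Import all_boot all_order all_algebra.
From mathcomp Require Import reals constructive_ereal.
From mathcomp Require Import zify lra ring.

Import Order.TTheory GRing.Theory Num.Theory.
Local Open Scope ring_scope.

(** * Splitting the components into two balanced groups *)

Lemma ncomponents_gt1 (H : sgraph) :
  ~~ connected_graph H -> (1 < ncomponents H)%N.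
Proof.
have Hc : connect_sym (@adj H) := sym_connect_sym (@adj_sym H).
case/forallPn=> x /forallPn[y nxy].
rewrite /ncomponents; apply/card_gt1P.
exists (fingraph.root (@adj H) x), (fingraph.root (@adj H) y).
by rewrite !inE !roots_root // root_connect.
Qed.

(** Components are named by their roots, and [A] is the union of [c./2] of them. Each side has at
    least one vertex per component, and [A] gains another from a nontrivial component. *)
Lemma balanced_closed_set (H : sgraph) (c := ncomponents H) :
  (1 < c)%N ->
  exists A : {set H},
    [/\ closed (@adj H) A, (c./2 <= #|A|)%N, (c./2 <= #|~: A|)%N
      & (c < #|H| -> c <= (#|A|).*2 /\ c <= (#|~: A|).*2)%N].
Proof.
move=> c_gt1.
have Hc : connect_sym (@adj H) := sym_connect_sym (@adj_sym H).
pose rt := fingraph.root (@adj H).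
pose Rts := [set x : H | rt x == x].
have rtK x : rt (rt x) = rt x by apply/eqP; exact: roots_root.
have cE : #|Rts| = c.
  by rewrite /c /ncomponents; apply: eq_card => x; rewrite !inE andbT.
(* Whenever some component has a second vertex [z], [r] is the root of such a component; it is
   forced into [A] below. *)
have [r rR rP] : exists2 r, r \in Rts &
    (c < #|H|)%N -> exists2 z, z \notin Rts & rt z = r.
  have [ltc|gec] := ltnP c #|H|.
    have /set0Pn[z] : ~: Rts != set0 by rewrite -card_gt0 cardsCs setCK; lia.
    by rewrite inE => zR; exists (rt z); [rewrite inE rtK | exists z].
  have /set0Pn[r rR] : Rts != set0 by rewrite -card_gt0; lia.
  by exists r.
have /card_geqP[s [s_uniq s_size sR]] : (c./2.-1 <= #|Rts :\ r|)%N.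
  have := cardsD1 r Rts; rewrite rR cE; lia.
pose B := r |: [set x in s].
have rs : r \notin s by apply/negP => /sR; rewrite !inE eqxx.
have BR : B \subset Rts.
  apply/subsetP => x; rewrite in_setU1 inE => /orP[/eqP->//|/sR].
  by rewrite in_setD1 => /andP[].
have cB : #|B| = c./2.
  by rewrite cardsU1 inE rs cardsE (card_uniqP s_uniq) s_size; lia.
pose A := [set x | rt x \in B].
have BA : B \subset A.
  apply/subsetP => x xB; rewrite inE.
  by have := subsetP BR _ xB; rewrite inE => /eqP->.
have CA : Rts :\: B \subset ~: A.
  by apply/subsetP => x; rewrite !inE => /andP[? /eqP->].
have cCB : #|Rts :\: B| = (c - c./2)%N by rewrite cardsD (setIidPr BR) cE cB.
have leA : (c./2 <= #|A|)%N by rewrite -cB subset_leq_card.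
have leCA : (c - c./2 <= #|~: A|)%N by rewrite -cCB subset_leq_card.
exists A; split=> //; last 2 first.
- by lia.
- move=> /rP[z zR rz].
  have : (c./2 < #|A|)%N.
    rewrite -cB; apply: proper_card; apply/properP; split=> //.
    exists z; first by rewrite inE rz setU11.
    by apply: contra zR => /(subsetP BR).
  by lia.
move=> x y xy; rewrite !inE.
by rewrite /rt (fingraph.rootP Hc (connect1 xy)).
Qed.

Lemma balanced_separation (G : sgraph) (S : {set G})
    (c := ncomponents (del_graph S)) :
  connected_graph G -> disconnecting S ->
  [/\ (0 < #|S|)%N, (1 < c)%N & exists X Y : {set G},
    [/\ [disjoint X & Y], forall x y, x \in X -> y \in Y -> ~~ adj x y,
        (#|X| + #|Y| + #|S| = #|G|)%N,
        [/\ c./2 <= #|X|, c./2 <= #|Y| & c <= #|X| + #|Y|]%N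
      & (c < #|X| + #|Y| -> c <= (#|X|).*2 /\ c <= (#|Y|).*2)%N]].
Proof.
move=> Gc /andP[_ /ncomponents_gt1 c_gt1].
have [A [Acl leA leCA ltA]] := balanced_closed_set _ c_gt1.
pose f (x : del_graph S) : G := val x.
have f_inj : injective f by exact: val_inj.
have cf (B : {set del_graph S}) : #|f @: B| = #|B| by rewrite card_imset.
have cG : (#|A| + #|~: A| + #|S| = #|G|)%N.
  rewrite cardsC card_sig -(cardC [in S]) addnC; congr addn.
pose X := [set f x | x in A]; pose Y := [set f x | x in ~: A].
have nadj x y : x \in X -> y \in Y -> ~~ adj x y.
  move=> /imsetP[x' xA ->] /imsetP[y' yA ->]; apply/negP => xy.
  by move: yA; rewrite inE -(Acl x' y') ?xA.
split=> //.
  (* Were [S] empty, [X] would be closed under adjacency in the connected graph [G] and yet miss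
     [f y]. *)
  rewrite card_gt0; apply/negP => /eqP S0.
  have /set0Pn[x xA] : A != set0 by rewrite -card_gt0; lia.
  have /set0Pn[y yA] : ~: A != set0 by rewrite -card_gt0; lia.
  have cl : closed (@adj G) X.
    apply: (intro_closed (sym_connect_sym (@adj_sym G))) => u v uv uA.
    have vS : v \notin S by rewrite S0 inE.
    apply: contraT => vA.
    have : v \in Y.
      apply/imsetP; exists (exist _ v vS) => //.
      by rewrite inE; apply: contra vA => ?; apply/imsetP; exists (exist _ v vS).
    by move/(nadj _ _ uA); rewrite uv.
  have /forallP/(_ (f x))/forallP/(_ (f y)) := Gc.
  move/(closed_connect cl); rewrite !mem_imset // xA.
  by move: yA; rewrite inE => /negPf->.
exists X, Y; rewrite !cf; split=> //.
- rewrite -setI_eq0 -imsetI ?setICr ?imset0 //.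
  by move=> ? ? _ _; exact: f_inj.
- by split=> //; rewrite cardsC max_card.
- by move=> ltc; apply: ltA; rewrite -(cardsC A).
Qed.

(** * Real inequalities for a cut *)

(** Clear denominators, using 4g(g+1) = 1/beta^2 - 1 and (s+y)(s+x) - xy = s(s+x+y). *)
Lemma weak_cut_inequality (R : realFieldType) (beta s x y : R)
    (g := (1 - beta) / (2 * beta)) :
  0 < beta -> 0 < s -> 0 <= x -> 0 <= y ->
  (x * y) / ((s + y) * (s + x)) <= beta ^+ 2 ->
  4 * g * (g + 1) * (x * y) <= s * (s + (x + y)).
Proof.
move=> b0 s0 x0 y0; rewrite ler_pdivrMr; last by apply: mulr_gt0; lra.
move=> h.
have -> : 4 * g * (g + 1) * (x * y) = (1 - beta ^+ 2) * (x * y) / beta ^+ 2.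
  by rewrite /g; field; rewrite gt_eqF.
rewrite ler_pdivrMr ?exprn_gt0 //.
have -> : s * (s + (x + y)) = (s + y) * (s + x) - x * y by ring.
lra.
Qed.

(** The difference of the two sides is (2x-k)(2y-k) + k(x+y-k). *)
Lemma four_mul_ge (R : realFieldType) (x y k : R) :
  k <= 2 * x -> k <= 2 * y -> k <= x + y -> 0 <= k -> k * (x + y) <= 4 * (x * y).
Proof.
move=> kx ky km k0.
have : 0 <= (2 * x - k) * (2 * y - k) by apply: mulr_ge0; lra.
have : 0 <= k * (x + y - k) by apply: mulr_ge0; lra.
lra.
Qed.

(** Put m = x+y. If s < gk, then s(s+m) < g^2 k^2 + gkm <= 4g(g+1)xy, because k^2 <= km <= 4xy. *)
Lemma cut_lower_bound (R : realFieldType) (g s x y k : R) :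
  0 < g -> 0 <= s -> 0 <= k -> k <= 2 * x -> k <= 2 * y -> k <= x + y ->
  4 * g * (g + 1) * (x * y) <= s * (s + (x + y)) -> g * k <= s.
Proof.
move=> g0 s0 k0 kx ky km h; rewrite leNgt; apply/negP => sk.
have xy : k * (x + y) <= 4 * (x * y) by exact: four_mul_ge.
have kk : k * k <= k * (x + y) by rewrite ler_wpM2l.
have h1 : s * (s + (x + y)) <= s * (g * k + (x + y)).
  by rewrite ler_wpM2l //; lra.
have h2 : s * (g * k + (x + y)) < g * k * (g * k + (x + y)).
  by rewrite ltr_pM2r //; lra.
have h3 : g * (k * (x + y)) <= g * (4 * (x * y)) by rewrite ler_pM2l.
have h4 : g * (g * (k * k)) <= g * (g * (4 * (x * y))).
  by rewrite !ler_pM2l //; lra.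
lra.
Qed.

(** The same argument, with strictness now coming from k^2 < km. *)
Lemma cut_lower_bound_lt (R : realFieldType) (g s x y k : R) :
  0 < g -> 0 <= s -> 0 < k -> k <= 2 * x -> k <= 2 * y -> k < x + y ->
  4 * g * (g + 1) * (x * y) <= s * (s + (x + y)) -> g * k < s.
Proof.
move=> g0 s0 k0 kx ky km h; rewrite ltNge; apply/negP => sk.
have xy : k * (x + y) <= 4 * (x * y).
  by apply: four_mul_ge => //; exact: ltW.
have kk : k * k < k * (x + y) by rewrite ltr_pM2l.
have h1 : s * (s + (x + y)) <= g * k * (g * k + (x + y)).
  by apply: ler_pM => //; lra.
have h3 : g * (k * (x + y)) <= g * (4 * (x * y)) by rewrite ler_pM2l.
have h4 : g * (g * (k * k)) < g * (g * (4 * (x * y))).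
  by rewrite !ltr_pM2l //; lra.
lra.
Qed.

(** * Bounds for a single disconnecting set *)

(** In the last alternative, [n%:R = s + c] records that every component is a single vertex. *)
Lemma disconnecting_set_bound (R : realType) (beta : R) (n : nat)
    (G : sgraph) (S : {set G}) (g := (1 - beta) / (2 * beta))
    (s : R := #|S|%:R) (c : R := (ncomponents (del_graph S))%:R) :
  0 < beta -> beta < 1 -> connected_graph G -> weakly_nbeta_graph n beta G ->
  disconnecting S ->
  g * (c - 1) < s /\
  (g * c <= s \/
   [/\ odd (ncomponents (del_graph S)), n%:R = s + c
     & g * (g + 1) * (c ^+ 2 - 1) <= s * (s + c)]).
Proof.
move=> b0 b1 Gc [cG wG] Sd.
have [S0 c1 [X [Y [dXY eXY cXY [hX hY hXY] lt_c]]]] :=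
  balanced_separation _ _ Gc Sd.
have g0 : 0 < g by apply: divr_gt0; lra.
have s0 : 0 < s by rewrite ltr0n.
have nE : n%:R = #|X|%:R + #|Y|%:R + s :> R by rewrite -cG -cXY !natrD.
have proper_of (Z : {set G}) : (#|Z| < #|G|)%N -> Z \proper [set: G].
  by move=> ltZ; rewrite properEcard subsetT cardsT.
have {}wG := wG X Y _ _ dXY eXY; move: wG.
have -> : n%:R - #|X|%:R = s + #|Y|%:R by rewrite nE; ring.
have -> : n%:R - #|Y|%:R = s + #|X|%:R by rewrite nE; ring.
move=> wG; have {}wG := wG (proper_of X ltac:(lia)) (proper_of Y ltac:(lia)).
have {wG} h := weak_cut_inequality _ _ _ _ _ b0 s0 (ler0n R _) (ler0n R _) wG.
have cE : c - 1 = (ncomponents (del_graph S)).-1%:R.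
  by rewrite /c -{1}(prednK (ltnW c1)) -natr1; ring.
split.
  (* Here k = c - 1, which is at most twice [c./2] and below |X| + |Y|. *)
  apply: cut_lower_bound_lt h => //;
    rewrite cE ?ltr0n -?natrD -?natrM ?ler_nat ?ltr_nat; lia.
have [od|ev] := boolP (odd (ncomponents (del_graph S))); last first.
  left; apply: cut_lower_bound h => //;
    rewrite /c -?natrD -?natrM ?ler_nat //; lia.
move: hXY; rewrite leq_eqVlt => /orP[/eqP eXYc|/[dup] ltc /lt_c[cX cY]]; last first.
  left; apply: cut_lower_bound h => //;
    rewrite /c -?natrD -?natrM ?ler_nat //; lia.
right; split=> //; first by rewrite nE /c eXYc natrD; ring.
have cE2 : c = #|X|%:R + #|Y|%:R by rewrite /c eXYc natrD.
have -> : c ^+ 2 - 1 = 4 * (#|X|%:R * #|Y|%:R).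
  (* Both sizes are at least [c./2] and their sum [c] is odd. *)
  have : (#|X| = #|Y|.+1 \/ #|Y| = #|X|.+1)%N by lia.
  by case=> E; rewrite cE2 E -natr1; ring.
by rewrite cE2 (mulrCA _ 4) !mulrA; rewrite !mulrA in h.
Qed.

(* The hypothesis [1 <= s] is where integrality of [#|S|] enters: for [c = 3]
   and [g] near 0 the quadratic inequality alone allows [s / (g * c)] near 8/9,
   which is less than 10/11. *)
Lemma odd_singletons_bound (R : realFieldType) (g s c : R) :
  0 < g -> 1 <= s -> c = 3 \/ 5 <= c ->
  g * (g + 1) * (c ^+ 2 - 1) <= s * (s + c) -> 10 / 11 * g * c < s.
Proof.
move=> g0 s1 c35 h; rewrite ltNge; apply/negP => sc.
have c3 : 3 <= c by case: c35; lra.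
have h1 : s * (s + c) <= 10 / 11 * g * c * (10 / 11 * g * c + c).
  by apply: ler_pM => //; lra.
have h2 : g * ((g + 1) * (c ^+ 2 - 1)) <=
          g * (10 / 11 * c ^+ 2 * (10 / 11 * g + 1)).
  by move: (le_trans h h1); rewrite mulrA; congr (_ <= _); ring.
move: h2; rewrite ler_pM2l // => h2.
(* For c >= 5, c^2 > 11 refutes [h2]. For c = 3, [h2] gives g <= 11/34, while 1 <= s <= 30g/11 gives
   g >= 11/30. *)
case: c35 => [c_eq|c5]; last first.
  have c25 : 5 * 5 <= c ^+ 2 by rewrite expr2; apply: ler_pM.
  have : 0 <= g * (c ^+ 2 - 25) by apply: mulr_ge0; lra.
  by lra.
by move: h2 sc; rewrite c_eq; lra.
Qed.

(** * Toughness bounds, uniform and asymptotic in n *)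

(** The disjunction on [beta] and [eps] excludes beta > 1 with eps > 1/2: there the asymptotic bound
    is positive, but large stars have toughness near 0. *)
Theorem theorem4p5 (R : realType) (beta : R) (hbeta : 0 < beta) :
  (forall (n : nat) (G : sgraph),
     (0 < n)%N -> connected_graph G -> weakly_nbeta_graph n beta G ->
     (((1 - beta) / (2 * beta))%:E < toughness' R G)%E /\
     (((5 * (1 - beta)) / (11 * beta))%:E < toughness R G)%E)
  /\
  (forall eps : R, 0 < eps -> beta <= 1 \/ eps <= 1 / 2 ->
     exists N : nat, forall (n : nat) (G : sgraph),
       (N <= n)%N ->
       (0 < n)%N -> connected_graph G -> weakly_nbeta_graph n beta G ->
       (((1 / 2 - eps) * ((1 - beta) / beta))%:E < toughness R G)%E).
Proof.
set g := (1 - beta) / (2 * beta).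
have gE : (1 - beta) / beta = 2 * g by rewrite /g; field; rewrite gt_eqF.
have -> : 5 * (1 - beta) / (11 * beta) = 10 / 11 * g.
  by rewrite /g; field; rewrite gt_eqF.
have g0 : beta < 1 -> 0 < g by move=> b1; apply: divr_gt0; lra.
have g_le0 : 1 <= beta -> g <= 0.
  by move=> b1; rewrite /g ler_pdivrMr; lra.
split=> [n G _ Gc wG|eps eps0 beps].
  have bounds (S : {set G}) : disconnecting S ->
      let c : R := (ncomponents (del_graph S))%:R in
      [/\ 0 < c - 1, g * (c - 1) < #|S|%:R & 10 / 11 * g * c < #|S|%:R].
    move=> Sd c; have [S0 c1 _] := balanced_separation _ _ Gc Sd.
    have s1 : 1 <= #|S|%:R :> R by rewrite ler1n.
    have c2 : 2 <= c by rewrite ler_nat.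
    (* For beta >= 1 both lower bounds are nonpositive, while |S| >= 1. *)
    have [/g_le0 gle|b1] := lerP 1 beta.
      have gc : g * (c - 1) <= 0 by apply: mulr_le0_ge0; lra.
      by split; [lra|lra|lra].
    have [hlt hor] := disconnecting_set_bound _ _ _ _ _ hbeta b1 Gc wG Sd.
    rewrite -/g -/c in hlt hor; have {}g0 := g0 b1.
    split=> //; first by lra.
    have gc : 0 < g * c by apply: mulr_gt0; lra.
    case: hor => [gcs|[od _ h]]; first by lra.
    apply: odd_singletons_bound h => //.
    have [c3|c5] : (ncomponents (del_graph S) = 3 \/
                    5 <= ncomponents (del_graph S))%N by lia.
      by left; rewrite /c c3.
    by right; rewrite ler_nat.
  split; apply/bigmin_gtP; split; rewrite ?ltry // => S /bounds[c1 lt1 lt2];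
    by rewrite lte_fin ltr_pdivlMr //; lra.
rewrite gE.
have [b1|b1] := lerP 1 beta.
  exists 0%N => n G _ _ Gc wG; apply/bigmin_gtP; split; rewrite ?ltry // => S Sd.
  have [S0 c1 _] := balanced_separation _ _ Gc Sd.
  rewrite lte_fin; apply: (@le_lt_trans _ _ 0).
    have := g_le0 b1; case: beps => [b1'|]; last by nra.
    have beta1 : beta = 1 by apply: le_anti; rewrite b1' b1.
    by rewrite /g beta1 subrr mul0r !mulr0.
  by apply: divr_gt0; rewrite ltr0n // ltnW.
have {}g0 := g0 b1.
(* This makes n exceed (1+g)/(2 eps), which bounds s + c in the odd case. *)
exists (Num.truncn ((1 + g) / (2 * eps))).+1 => n G ltN _ Gc wG.
apply/bigmin_gtP; split; rewrite ?ltry // => S Sd.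
have [S0 c1 _] := balanced_separation _ _ Gc Sd.
have [hlt hor] := disconnecting_set_bound _ _ _ _ _ hbeta b1 Gc wG Sd.
move: hlt hor; rewrite -/g => hlt hor.
set s : R := #|S|%:R in hlt hor *; set c : R := _%:R in hlt hor *.
have c2 : 2 <= c by rewrite ler_nat.
rewrite lte_fin ltr_pdivlMr; last lra.
rewrite ltNge; apply/negP => sc.
have gc : 0 < g * c by apply: mulr_gt0; lra.
have egc : 0 < eps * (g * c) by apply: mulr_gt0.
case: hor => [|[_ nE _]]; first by lra.
have : (1 + g) / (2 * eps) < n%:R.
  by apply: lt_le_trans (truncnS_gt _) _; rewrite ler_nat.
rewrite ltr_pdivrMr; last lra.
(* Compare g(c-1) < s with s <= (1 - 2 eps)gc. *)
have cb : 2 * eps * c < 1.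
  have : g * (2 * eps * c) < g * 1 by lra.
  by rewrite ltr_pM2l.
have : n%:R <= (1 + g) * c by rewrite nE; lra.
move=> h1; have : n%:R * (2 * eps) <= (1 + g) * c * (2 * eps).
  by rewrite ler_pM2r //; lra.
have : (1 + g) * (2 * eps * c) < (1 + g) * 1 by rewrite ltr_pM2l //; lra.
lra.
Qed.
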